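(* For an integer $n\ge1$ let $$f_n(x):=\frac1n\sum_{j=0}^{n-1}e^{n z_j\sqrt[n]{x}}=\sum_{k=0}^\infty\frac{n^{nk}x^k}{(nk)!},\qquad z_j:=e^{\frac{2\pi i j}{n}}.$$ Let $m\ge0$ be an integer. Then for any complex numbers $a_1,\dots,a_m$ and $c_1,\dots,c_{m+n-1}$ such that $c_i\notin\{0,-1,-2,\dots\}$ for all $i$, it holds $${}_mF_{m+n-1}(a_1,\dots,a_m;c_1,\dots,c_{m+n-1};x)=\mathcal{H}_{c_1}^{\frac1n}\mathcal{H}_{c_2}^{\frac2n}\cdots\mathcal{H}_{c_{n-1}}^{\frac{n-1}{n}}\,\mathcal{H}_{c_n}^{a_1}\cdots\mathcal{H}_{c_{n+m-1}}^{a_m}\,f_n(x).$$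
   Context: $(q)_n=q(q+1)\cdots(q+n-1)$, $(q)_0=1$. $C^\omega$ is the space of functions analytic near $0\in\mathbb{C}$; for $a,c\in\mathbb{C}$ with $c\notin\{0,-1,-2,\dots\}$ the hypergeometrization is the linear operator $\mathcal{H}_c^a:C^\omega\to C^\omega$, $\mathcal{H}_c^a\left(\sum_k f_kx^k\right)=\sum_k f_k\frac{(a)_k}{(c)_k}x^k$. The generalized hypergeometric function is ${}_pF_q(a_1,\dots,a_p;c_1,\dots,c_q;x):=\sum_{k=0}^\infty\frac{(a_1)_k\cdots(a_p)_k}{(c_1)_k\cdots(c_q)_k}\frac{x^k}{k!}$. *)

(* Defs.v *)
(* Stdlib reals with Coquelicot's complex numbers [C]. *)
From Stdlib Require Import Reals Factorial Lra Lia List ClassicalEpsilon.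
From Coquelicot Require Import Coquelicot.

Open Scope C_scope.

Definition Cexp (z : C) : C := RtoC (exp (Re z)) * (cos (Im z), sin (Im z)).

Definition Cis_series (t : nat -> C) (s : C) : Prop :=
  @is_series C_AbsRing C_NormedModule t s.

Definition Cex_series (t : nat -> C) : Prop := exists s : C, Cis_series t s.

(* The sum of a convergent series; unspecified when the series diverges. *)
Definition CSeries (t : nat -> C) : C :=
  @iota C_CompleteNormedModule (Cis_series t).

Fixpoint pochhammer (q : C) (k : nat) : C :=
  match k with
  | O => 1
  | S j => pochhammer q j * (q + INR j)
  end.

Definition Cprod (l : list C) : C := fold_right Cmult 1 l.

(* [a] is the sequence of Taylor coefficients of [f] at 0. *)
Definition expands_at0 (f : C -> C) (a : nat -> C) : Prop :=
  exists r : R, 0 < r /\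
    forall x : C, Cmod x < r -> Cis_series (fun k => a k * x ^ k) (f x).

(* The coefficients are unique when [f] is analytic near 0; otherwise the value
   is unspecified. *)
Definition taylor0 (f : C -> C) : nat -> C :=
  epsilon (inhabits (fun _ : nat => RtoC 0)) (expands_at0 f).

(* [hypergeometrization a c] is the operator with upper parameter [a] and
   lower parameter [c].  An element of the space of functions analytic near 0
   is represented by any function [C -> C] having an expansion at 0; the result
   depends only on the germ of [f] at 0, and is defined at every point where the
   resulting power series converges. *)
Definition hypergeometrization (a c : C) (f : C -> C) : C -> C :=
  fun x => CSeries (fun k =>
    taylor0 f k * (pochhammer a k / pochhammer c k) * x ^ k).

(* [[(a1, c1); ...; (ar, cr)]] gives the composite operator whose outermost
   factor has parameters [a1], [c1] and which applies [ar], [cr] first. *)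
Definition hypergeometrizations (l : list (C * C)) (f : C -> C) : C -> C :=
  fold_right (fun p g => hypergeometrization (fst p) (snd p) g) f l.

Definition hyper_term (a c : list C) (x : C) (k : nat) : C :=
  Cprod (map (fun q => pochhammer q k) a) /
  Cprod (map (fun q => pochhammer q k) c) * (x ^ k / INR (fact k)).

(* The generalized hypergeometric function, of type (length a, length c). *)
Definition pFq (a c : list C) (x : C) : C := CSeries (hyper_term a c x).

Definition unity_root (n j : nat) : C := Cexp (2 * PI * Ci * INR j / INR n).

(* A branch of the n-th root, with no continuity requirement. *)
Definition is_root_branch (n : nat) (root : C -> C) : Prop :=
  forall x : C, root x ^ n = x.

Definition exp_mean (n : nat) (root : C -> C) (x : C) : C :=
  / INR n * fold_right Cplus 0
    (map (fun j => Cexp (INR n * unity_root n j * root x)) (seq 0 n)).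

Lemma ex_root_branch (n : nat) :
  (1 <= n)%nat -> exists root : C -> C, is_root_branch n root.
Proof.
  intros hn.
  assert (H : forall x : C, exists y : C, y ^ n = x).
  { intros x.
    destruct (Ceq_dec x 0) as [->|hx].
    { exists 0. destruct n; [lia|]. rewrite Cpow_S. ring. }
    assert (hm : (0 < Cmod x)%R) by now apply Cmod_gt_0.
    assert (moivre : forall (r t : R) (k : nat),
      (RtoC r * (cos t, sin t)) ^ k
      = RtoC (r ^ k) * (cos (INR k * t), sin (INR k * t))).
    { intros r t k. induction k as [|k IH].
      - simpl. rewrite Rmult_0_l, cos_0, sin_0.
        apply injective_projections; simpl; ring.
      - rewrite Cpow_S, IH, S_INR, Rmult_plus_distr_r, Rmult_1_l, cos_plus, sin_plus.
        apply injective_projections; simpl; ring. }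
    assert (arg : exists t : R, x = RtoC (Cmod x) * (cos t, sin t)).
    { destruct x as [u v]. set (r := Cmod (u, v)) in *.
      assert (hr : (r * r = u * u + v * v)%R).
      { unfold r, Cmod. simpl.
        replace (u * u + v * v)%R with (u * (u * 1) + v * (v * 1))%R by ring.
        apply sqrt_sqrt. nra. }
      set (q := (u / r)%R).
      assert (hu : u = (r * q)%R) by (unfold q; field; lra).
      assert (hq : (-1 <= q <= 1)%R).
      { assert (q * q <= 1)%R; [|nra].
        apply Rmult_le_reg_l with (r * r)%R; nra. }
      assert (hs : (r * sqrt (1 - q²) = Rabs v)%R).
      { rewrite <- (sqrt_Rsqr r) at 1 by lra. rewrite <- sqrt_mult_alt by apply Rle_0_sqr.
        rewrite <- sqrt_Rsqr_abs. f_equal. unfold Rsqr. nra. }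
      destruct (Rle_dec 0 v) as [hv|hv].
      - exists (acos q). rewrite cos_acos, sin_acos by easy.
        rewrite Rabs_pos_eq in hs by easy.
        apply injective_projections; simpl; lra.
      - exists (- acos q)%R. rewrite cos_neg, sin_neg, cos_acos, sin_acos by easy.
        rewrite Rabs_left in hs by lra.
        apply injective_projections; simpl; lra. }
    destruct arg as [t ht].
    assert (hn0 : (0 < INR n)%R) by (apply lt_0_INR; lia).
    exists (RtoC (Rpower (Cmod x) (/ INR n)) * (cos (t / INR n), sin (t / INR n))).
    rewrite moivre, <- Rpower_pow by apply exp_pos.
    rewrite Rpower_mult, Rinv_l, Rpower_1 by lra.
    replace (INR n * (t / INR n))%R with t by (field; lra).
    now symmetry. }
  exists (fun x => epsilon (inhabits (RtoC 0)) (fun y => y ^ n = x)).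
  intros x. apply (epsilon_spec (inhabits (RtoC 0)) (fun y => y ^ n = x)), H.
Qed.

(* Main.v *)
Require Import Defs.
From Stdlib Require Import Reals Factorial List Lra Lia
  FunctionalExtensionality ClassicalEpsilon.
From Coquelicot Require Import Coquelicot.
Open Scope C_scope.

(** On an analytic germ the operator with parameters [a], [c] multiplies the
    [k]-th Taylor coefficient by [(a)_k / (c)_k].  Both sides of the formula are
    therefore power series, and it suffices to compare their coefficients: the
    claim reduces to

      [n^(nk) / (nk)! * prod_(j=1)^(n-1) (j/n)_k = 1 / k!],

    which is Gauss multiplication ([pochhammer_multiplication]): the factors
    of [(nk)!] are grouped by their residues modulo [n], and the residue [j] in
    [1 .. n] contributes [n^k (j/n)_k], with [(n/n)_k = k!].

    The analytic content is what justifies this reading.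

    - The mean of the exponentials has the stated expansion
      ([exp_mean_series]).  Each exponential is the sum of its Taylor series
      ([Cexp_series]); averaging over the [n]-th roots of unity kills the powers
      whose exponent is not a multiple of [n] and keeps the others, so that only
      [(root x)^(nk) = x^k] remains, whichever root is chosen.
    - The Taylor coefficients of a function are determined by the function
      ([taylor0_unique]), so that an operator applied to the result of another
      one sees exactly the coefficients produced by the latter.
    - The ratios [(a)_k / (c)_k] grow at most geometrically
      ([pochhammer_ratio_bound]).  Hence each operator maps analytic germs to
      analytic germs ([hypergeometrization_expansion]), and since the series of
      the mean converges everywhere, so does the hypergeometric series. *)

(** * Series of complex numbers *)

Lemma RtoC_neq (x y : R) : x <> y -> RtoC x <> RtoC y.
Proof. intros h e. now apply h, RtoC_inj. Qed.

Lemma Cis_series_iff (t : nat -> C) (s : C) :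
  Cis_series t s <->
  forall eps : R, 0 < eps ->
    exists N, forall n, (N <= n)%nat -> Cmod (@sum_n C_AbelianMonoid t n - s) < eps.
Proof.
  unfold Cis_series, is_series.
  split.
  - intros H eps he.
    exact (proj1 (@filterlim_locally_ball_norm C_AbsRing nat C_NormedModule _ _ (sum_n t) s) H (mkposreal eps he)).
  - intros H.
    apply (proj2 (@filterlim_locally_ball_norm C_AbsRing nat C_NormedModule _ _ (sum_n t) s)).
    intros eps. exact (H eps (cond_pos eps)).
Qed.

Lemma Cis_series_unique (t : nat -> C) (s1 s2 : C) :
  Cis_series t s1 -> Cis_series t s2 -> s1 = s2.
Proof. exact (@filterlim_locally_unique nat C_AbsRing C_NormedModule eventually _ (@sum_n C_AbelianMonoid t) s1 s2). Qed.

Lemma CSeries_unique (t : nat -> C) (s : C) : Cis_series t s -> CSeries t = s.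
Proof.
  intros H. apply (@iota_unique C_AbsRing C_CompleteNormedModule); [|exact H].
  intros y hy. now apply Cis_series_unique with t.
Qed.

Lemma CSeries_correct (t : nat -> C) : Cex_series t -> Cis_series t (CSeries t).
Proof. intros [s hs]. now rewrite (CSeries_unique _ _ hs). Qed.

Lemma Cis_series_ext (t u : nat -> C) (s : C) :
  (forall k, t k = u k) -> Cis_series t s -> Cis_series u s.
Proof. apply (@is_series_ext C_AbsRing C_NormedModule). Qed.

Lemma CSeries_ext (t u : nat -> C) : (forall k, t k = u k) -> CSeries t = CSeries u.
Proof.
  intros H. now rewrite (functional_extensionality t u H).
Qed.

Lemma Cex_series_le (t : nat -> C) (b : nat -> R) :
  (forall k, Cmod (t k) <= b k) -> ex_series b -> Cex_series t.
Proof. apply (@ex_series_le C_AbsRing C_CompleteNormedModule). Qed.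

Lemma Re_sum_n (t : nat -> C) (N : nat) :
  Re (@sum_n C_AbelianMonoid t N) = sum_n (fun k => Re (t k)) N.
Proof.
  induction N as [|N IH]; [now rewrite !sum_O|].
  rewrite !sum_Sn, <- IH. reflexivity.
Qed.

Lemma Cis_series_Re (t : nat -> C) (s : C) :
  Cis_series t s -> is_series (fun k => Re (t k)) (Re s).
Proof.
  intros H. apply (proj2 (filterlim_locally_ball_norm (sum_n (fun k => Re (t k))) (Re s))).
  intros eps. destruct (proj1 (Cis_series_iff t s) H eps (cond_pos eps)) as [N hN].
  exists N. intros n hn. unfold ball_norm. rewrite <- Re_sum_n.
  apply Rle_lt_trans with (2 := hN n hn).
  exact (re_le_Cmod (@sum_n C_AbelianMonoid t n - s)).
Qed.

Lemma Cis_series_scal (w : C) (t : nat -> C) (s : C) :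
  Cis_series t s -> Cis_series (fun k => w * t k) (w * s).
Proof. apply (@is_series_scal C_AbsRing C_NormedModule). Qed.

Lemma Cex_series_terms_bounded (t : nat -> C) :
  Cex_series t -> exists M : R, forall k, Cmod (t k) <= M.
Proof.
  intros [s hs].
  destruct (@filterlim_bounded C_AbsRing C_NormedModule (@sum_n C_AbelianMonoid t)) as [M hM].
  { now exists s. }
  assert (h : forall k, Cmod (@sum_n C_AbelianMonoid t k) <= M) by exact hM.
  exists (2 * M)%R. intros [|k].
  - generalize (h 0%nat), (Cmod_ge_0 (@sum_n C_AbelianMonoid t 0)). rewrite sum_O. lra.
  - replace (t (S k)) with (@sum_n C_AbelianMonoid t (S k) + - @sum_n C_AbelianMonoid t k).
    + eapply Rle_trans; [apply Cmod_triangle|]. rewrite Cmod_opp.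
      generalize (h k), (h (S k)). lra.
    + rewrite sum_Sn. change (@plus C_AbelianMonoid) with Cplus. ring.
Qed.

(** * The exponential series on the complex plane *)

Lemma Cmod_Cexp (z : C) : Cmod (Cexp z) = exp (Re z).
Proof.
  unfold Cexp. rewrite Cmod_mult, Cmod_R, Rabs_pos_eq by (left; apply exp_pos).
  unfold Cmod; simpl.
  replace (_ + _)%R with 1%R by (generalize (sin2_cos2 (Im z)); unfold Rsqr; simpl; lra).
  rewrite sqrt_1. ring.
Qed.

Lemma Cexp_plus (z w : C) : Cexp (z + w) = Cexp z * Cexp w.
Proof.
  unfold Cexp. destruct z as [a b], w as [c d]; simpl.
  rewrite exp_plus, cos_plus, sin_plus. apply injective_projections; simpl; ring.
Qed.

Lemma is_derive_Re_Cexp_ray (z w : C) (t : R) :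
  is_derive (fun t : R => Re (w * Cexp (t * z))) t (Re (w * z * Cexp (t * z))).
Proof.
  destruct z as [a b], w as [c d]. unfold Cexp; simpl.
  auto_derive; [easy|]. unfold Rminus. ring.
Qed.

Lemma is_derive_n_Re_Cexp_ray (z w : C) (k : nat) (t : R) :
  is_derive_n (fun t : R => Re (w * Cexp (t * z))) k t (Re (w * z ^ k * Cexp (t * z))).
Proof.
  revert t. induction k as [|k IH]; intros t.
  - unfold is_derive_n. now replace (w * z ^ 0) with w by (simpl; ring).
  - replace (w * z ^ S k) with (w * z ^ k * z) by (simpl; ring).
    apply is_derive_ext with (fun t : R => Re (w * z ^ k * Cexp (t * z))).
    + intros u. symmetry. apply is_derive_n_unique, IH.
    + apply is_derive_Re_Cexp_ray.
Qed.

(** The Lagrange form of the remainder holds for real functions of a real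
    variable, so it is used for [t |-> Re (w * Cexp (t * z))] on [[0, 1]].  The
    choice of [w] as the conjugate of the remainder [d] makes [Re (w * d)] equal
    to [|d|^2], which bounds the real and imaginary parts together. *)
Lemma Cexp_remainder (z : C) (N : nat) :
  Cmod (@sum_n C_AbelianMonoid (fun k => z ^ k / INR (fact k)) N - Cexp z)
  <= exp (Cmod z) * (Cmod z ^ S N / INR (fact (S N))).
Proof.
  set (S := @sum_n C_AbelianMonoid _ N). set (d := S - Cexp z).
  set (B := (_ * _)%R).
  assert (hB : 0 <= B).
  { unfold B. apply Rmult_le_pos; [left; apply exp_pos|]. apply Rdiv_le_0_compat.
    - apply pow_le, Cmod_ge_0.
    - apply INR_fact_lt_0. }
  set (w := Cconj d).
  destruct (Taylor_Lagrange (fun t : R => Re (w * Cexp (t * z))) N 0 1) as [xi [hxi H]].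
  { lra. }
  { intros t _ [|k] _; [easy|]. eexists. apply (is_derive_n_Re_Cexp_ray z w (Datatypes.S k)). }
  rewrite (is_derive_n_unique _ _ _ _ (is_derive_n_Re_Cexp_ray z w (Datatypes.S N) xi)) in H.
  assert (hsum : sum_f_R0 (fun m => (1 - 0) ^ m / INR (fact m) *
       Derive_n (fun t : R => Re (w * Cexp (t * z))) m 0)%R N = Re (w * S)).
  { rewrite <- sum_n_Reals.
    change (w * S) with (mult w (S : C_Ring)). unfold S.
    rewrite <- (@sum_n_mult_l C_Ring). rewrite (Re_sum_n (fun k => w * (z ^ k / INR (fact k)))).
    apply sum_n_ext. intros k.
    rewrite (is_derive_n_unique _ _ _ _ (is_derive_n_Re_Cexp_ray z w k 0)).
    replace (w * (z ^ k / INR (fact k))) with (RtoC (/ INR (fact k)) * (w * z ^ k)).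
    2:{ rewrite RtoC_inv by apply INR_fact_neq_0. unfold Cdiv. ring. }
    replace (Cexp (0 * z)) with (RtoC 1).
    2:{ unfold Cexp. destruct z as [a b]; simpl. rewrite !Rmult_0_l, Rminus_0_r, Rplus_0_r.
        rewrite exp_0, cos_0, sin_0. apply injective_projections; simpl; ring. }
    rewrite Cmult_1_r. rewrite Rminus_0_r, pow1. unfold Rdiv. rewrite Rmult_1_l.
    generalize (w * z ^ k). intros [a b]. simpl. ring. }
  rewrite hsum in H. rewrite Cmult_1_l in H.
  assert (hd : (Cmod d * Cmod d = Re (w * S) - Re (w * Cexp z))%R).
  { replace (_ - _)%R with (Re (w * d)).
    2:{ unfold d. destruct w, S, (Cexp z); simpl; ring. }
    unfold w. rewrite Cmult_comm, <- Cmod2_conj. simpl. ring. }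
  destruct (Req_dec (Cmod d) 0) as [h0|h0]; [rewrite h0; exact hB|].
  assert (hp : 0 < Cmod d) by (generalize (Cmod_ge_0 d); lra).
  apply Rmult_le_reg_l with (1 := hp).
  rewrite hd, H.
  replace (_ - _)%R with (- ((1 - 0) ^ Datatypes.S N / INR (fact (Datatypes.S N)) *
    Re (w * z ^ Datatypes.S N * Cexp (xi * z))))%R by ring.
  eapply Rle_trans; [apply Rle_abs|]. rewrite Rabs_Ropp, Rminus_0_r, pow1, Rabs_mult.
  rewrite Rabs_pos_eq.
  2:{ apply Rdiv_le_0_compat; [lra|apply INR_fact_lt_0]. }
  apply Rle_trans with (1 / INR (fact (Datatypes.S N)) *
     (Cmod d * Cmod z ^ Datatypes.S N * exp (Cmod z)))%R.
  - apply Rmult_le_compat_l.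
    { apply Rdiv_le_0_compat; [lra|apply INR_fact_lt_0]. }
    eapply Rle_trans; [apply re_le_Cmod|].
    rewrite !Cmod_mult, Cmod_Cexp, Cmod_pow. unfold w. rewrite Cmod_conj.
    apply Rmult_le_compat_l.
    { apply Rmult_le_pos; [lra|apply pow_le, Cmod_ge_0]. }
    assert (exp_le : forall u v : R, u <= v -> exp u <= exp v).
    { intros u v [h| ->]; [left; now apply exp_increasing|apply Rle_refl]. }
    apply exp_le.
    eapply Rle_trans; [apply Rle_abs|]. eapply Rle_trans; [apply re_le_Cmod|].
    rewrite Cmod_mult, Cmod_R, Rabs_pos_eq by lra.
    generalize (Cmod_ge_0 z). nra.
  - unfold B. right. field. apply INR_fact_neq_0.
Qed.

Lemma Cexp_series (z : C) : Cis_series (fun k => z ^ k / INR (fact k)) (Cexp z).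
Proof.
  apply Cis_series_iff. intros eps he.
  destruct (cv_speed_pow_fact (Cmod z) (eps / exp (Cmod z))%R) as [N hN].
  { apply Rdiv_lt_0_compat; [easy|apply exp_pos]. }
  exists N. intros n hn. eapply Rle_lt_trans; [apply Cexp_remainder|].
  specialize (hN (S n) ltac:(lia)). unfold Rdist in hN. rewrite Rminus_0_r in hN.
  apply Rle_lt_trans with (1 := Rmult_le_compat_l _ _ _ (Rlt_le _ _ (exp_pos _)) (Rle_abs _)).
  apply Rlt_le_trans with (1 := Rmult_lt_compat_l _ _ _ (exp_pos _) hN).
  right. field. apply Rgt_not_eq, exp_pos.
Qed.

(** * Uniqueness of Taylor coefficients *)

(** Restriction to real arguments turns the complex expansion, multiplied by
    [w] and reduced to its real part, into a real power series, whose
    coefficients are determined by its sum.  The cases [w = 1] and [w = - Ci]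
    give the real and the imaginary parts of the coefficients. *)
Lemma expands_at0_Re_coef (f : C -> C) (a b : nat -> C) (w : C) (k : nat) :
  expands_at0 f a -> expands_at0 f b -> Re (w * a k) = Re (w * b k).
Proof.
  assert (real_part : forall a r, 0 < r ->
    (forall x : C, Cmod x < r -> Cis_series (fun k => a k * x ^ k) (f x)) ->
    Rbar_lt 0 (CV_radius (fun k => Re (w * a k))) /\
    forall t : R, Rabs t < r -> PSeries (fun k => Re (w * a k)) t = Re (w * f t)).
  { clear. intros a r hr H.
    assert (hRe : forall (t : R) (k : nat),
      Re (w * (a k * RtoC t ^ k)) = (Re (w * a k) * t ^ k)%R).
    { intros t k. rewrite <- RtoC_pow. destruct w, (a k). simpl. ring. }
    split.
    - destruct (Cex_series_terms_bounded (fun k => w * (a k * RtoC (r / 2) ^ k))) as [M hM].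
      { exists (w * f (r / 2)%R). apply Cis_series_scal, H.
        rewrite Cmod_R, Rabs_pos_eq; lra. }
      apply Rbar_lt_le_trans with (Finite (r / 2)); [simpl; lra|].
      apply (CV_radius_bounded (fun k => Re (w * a k))). exists M. intros k.
      rewrite <- hRe. eapply Rle_trans; [apply re_le_Cmod|]. apply hM.
    - intros t ht. apply is_pseries_unique, is_pseries_R.
      apply is_series_ext with (fun k => Re (w * (a k * RtoC t ^ k))); [intros; apply hRe|].
      apply Cis_series_Re, Cis_series_scal, H. now rewrite Cmod_R. }
  intros [r1 [hr1 H1]] [r2 [hr2 H2]].
  destruct (real_part a r1 hr1 H1) as [hca hsa], (real_part b r2 hr2 H2) as [hcb hsb].
  apply (PSeries_ext_recip (fun k => Re (w * a k)) (fun k => Re (w * b k)) k hca hcb).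
  assert (hr : 0 < Rmin r1 r2) by now apply Rmin_pos.
  exists (mkposreal _ hr). intros t ht.
  assert (ht' : Rabs t < Rmin r1 r2).
  { unfold ball, AbsRing_ball, abs, minus, plus, opp in ht; simpl in ht.
    unfold AbsRing_ball in ht; simpl in ht. now replace t with (t + - 0)%R by ring. }
  rewrite hsa, hsb; [easy| |].
  - apply Rlt_le_trans with (1 := ht'), Rmin_r.
  - apply Rlt_le_trans with (1 := ht'), Rmin_l.
Qed.

Lemma taylor0_unique (f : C -> C) (b : nat -> C) (k : nat) :
  expands_at0 f b -> taylor0 f k = b k.
Proof.
  intros hb.
  assert (ht : expands_at0 f (taylor0 f)) by (unfold taylor0; apply epsilon_spec; now exists b).
  generalize (expands_at0_Re_coef f _ _ 1 k ht hb) (expands_at0_Re_coef f _ _ (- Ci) k ht hb).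
  destruct (taylor0 f k), (b k). simpl. intros. apply injective_projections; simpl; lra.
Qed.

(** * Hypergeometrization acts on coefficients *)

(** Only finitely many [j] satisfy [|c + j| < 1], and none of them gives 0. *)
Lemma Cmod_add_nat_lower_bound (c : C) : (forall k : nat, c <> - INR k) ->
  exists d : R, 0 < d /\ forall j : nat, d <= Cmod (c + INR j).
Proof.
  intros hc.
  assert (initial : forall N, exists d : R, 0 < d /\ forall j, (j < N)%nat -> d <= Cmod (c + INR j)).
  { induction N as [|N [d [hd H]]]; [exists 1%R; split; [lra|lia]|].
    assert (hN : 0 < Cmod (c + INR N)).
    { apply Cmod_gt_0. intros e. apply (hc N).
      replace c with (c + INR N - INR N) by ring. rewrite e. ring. }
    exists (Rmin d (Cmod (c + INR N))). split; [now apply Rmin_pos|].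
    intros j hj. destruct (Nat.eq_dec j N) as [->|hjN]; [apply Rmin_r|].
    apply Rle_trans with d; [apply Rmin_l|apply H; lia]. }
  destruct (INR_unbounded (Cmod c + 1)) as [N hN].
  destruct (initial N) as [d [hd H]].
  exists (Rmin d 1). split; [apply Rmin_pos; lra|].
  intros j. destruct (Nat.lt_ge_cases j N) as [hj|hj].
  - apply Rle_trans with d; [apply Rmin_l|now apply H].
  - apply Rle_trans with 1%R; [apply Rmin_r|].
    apply le_INR in hj.
    assert (h : Cmod (INR j) <= Cmod (c + INR j) + Cmod c).
    { replace (RtoC (INR j)) with (c + INR j + - c) at 1 by ring.
      rewrite <- (Cmod_opp c). apply Cmod_triangle. }
    rewrite Cmod_R, Rabs_pos_eq in h by apply pos_INR. lra.
Qed.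

Lemma pochhammer_neq_0 (c : C) (k : nat) :
  (forall k : nat, c <> - INR k) -> pochhammer c k <> 0.
Proof.
  intros hc. induction k as [|k IH]; simpl; [apply RtoC_neq; lra|].
  apply Cmult_neq_0; [easy|]. intros e. apply (hc k).
  replace c with (c + INR k - INR k) by ring. rewrite e. ring.
Qed.

(** Each step multiplies the ratio by [(a + k) / (c + k)], that is by
    [1 + (a - c) / (c + k)], which is bounded because [|c + k|] is bounded below. *)
Lemma pochhammer_ratio_bound (a c : C) : (forall k : nat, c <> - INR k) ->
  exists B : R, 0 < B /\ forall k, Cmod (pochhammer a k / pochhammer c k) <= B ^ k.
Proof.
  intros hc. destruct (Cmod_add_nat_lower_bound c hc) as [d [hd Hd]].
  set (B := (Cmod (a - c) / d + 1)%R).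
  assert (hB : 0 < B).
  { assert (0 <= Cmod (a - c) / d); [|unfold B; lra].
    apply Rdiv_le_0_compat; [apply Cmod_ge_0|easy]. }
  exists B. split; [easy|]. induction k as [|k IH].
  - simpl. replace (1 / 1) with (RtoC 1) by field. rewrite Cmod_1. lra.
  - simpl pochhammer.
    assert (hck : c + INR k <> 0).
    { intros e. specialize (Hd k). rewrite e, Cmod_0 in Hd. lra. }
    replace (_ / _) with ((a + INR k) / (c + INR k) * (pochhammer a k / pochhammer c k)).
    2:{ field. split; [easy|now apply pochhammer_neq_0]. }
    rewrite Cmod_mult. simpl pow. apply Rmult_le_compat; try apply Cmod_ge_0; [|easy].
    replace ((a + INR k) / (c + INR k)) with ((a - c) / (c + INR k) + 1) by (field; easy).
    eapply Rle_trans; [apply Cmod_triangle|]. rewrite Cmod_1. unfold B, Cdiv.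
    rewrite Cmod_mult, Cmod_inv by easy. apply Rplus_le_compat_r, Rmult_le_compat_l.
    + apply Cmod_ge_0.
    + apply Rinv_le_contravar; [easy|apply Hd].
Qed.

(** Convergence at [y] bounds [|b k| * |y|^k], so the terms at [x] are
    dominated by a geometric series of ratio [B * |x| / |y|]. *)
Lemma Cex_series_dominated (b d : nat -> C) (B : R) (x y : C) :
  Cex_series (fun k => b k * y ^ k) ->
  (forall k, Cmod (d k) <= Cmod (b k) * B ^ k) -> 0 <= B -> B * Cmod x < Cmod y ->
  Cex_series (fun k => d k * x ^ k).
Proof.
  intros hb hd hB hxy.
  destruct (Cex_series_terms_bounded _ hb) as [M hM].
  assert (hx := Cmod_ge_0 x).
  assert (hy : 0 < Cmod y) by nra.
  set (q := (B * Cmod x / Cmod y)%R).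
  assert (hq : 0 <= q < 1).
  { unfold q. split.
    - apply Rdiv_le_0_compat; [nra|easy].
    - apply Rmult_lt_reg_r with (Cmod y); [easy|]. field_simplify; lra. }
  apply Cex_series_le with (fun k => M * q ^ k)%R.
  - intros k. rewrite Cmod_mult, Cmod_pow.
    apply Rle_trans with (Cmod (b k) * B ^ k * Cmod x ^ k)%R.
    { apply Rmult_le_compat_r; [now apply pow_le|apply hd]. }
    replace (_ * _)%R with (Cmod (b k * y ^ k) * q ^ k)%R.
    + apply Rmult_le_compat_r; [now apply pow_le|apply hM].
    + rewrite Cmod_mult, Cmod_pow. unfold q, Rdiv.
      rewrite !Rpow_mult_distr, pow_inv. field. apply pow_nonzero. lra.
  - apply (ex_series_scal_l M (fun k => q ^ k)%R), ex_series_geom. rewrite Rabs_pos_eq; lra.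
Qed.

(** The radius of convergence shrinks by a finite factor only, which keeps
    the result analytic.  The formula for the values is recorded at every
    [x], including those where the series need not converge, since the operator
    is defined by this sum everywhere. *)
Lemma hypergeometrization_expansion (a c : C) (f : C -> C) (b : nat -> C) :
  (forall k : nat, c <> - INR k) -> expands_at0 f b ->
  let d k := b k * (pochhammer a k / pochhammer c k) in
  expands_at0 (hypergeometrization a c f) d /\
  forall x, hypergeometrization a c f x = CSeries (fun k => d k * x ^ k).
Proof.
  intros hc hb d.
  assert (eqH : forall x, hypergeometrization a c f x = CSeries (fun k => d k * x ^ k)).
  { intros x. apply CSeries_ext. intros k. now rewrite (taylor0_unique f b k hb). }
  split; [|exact eqH].
  destruct hb as [r [hr Hr]]. destruct (pochhammer_ratio_bound a c hc) as [B [hB HB]].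
  exists (r / (2 * B))%R. split; [apply Rdiv_lt_0_compat; lra|].
  intros x hx. rewrite eqH. apply CSeries_correct.
  apply Cex_series_dominated with (b := b) (B := B) (y := RtoC (r / 2)).
  - exists (f (r / 2)%R). apply Hr. rewrite Cmod_R, Rabs_pos_eq; lra.
  - intros k. unfold d. rewrite Cmod_mult. apply Rmult_le_compat_l; [apply Cmod_ge_0|apply HB].
  - lra.
  - rewrite Cmod_R, Rabs_pos_eq by lra.
    apply (Rmult_lt_compat_l B) in hx; [|easy].
    replace (B * (r / (2 * B)))%R with (r / 2)%R in hx by (field; lra). easy.
Qed.

Definition pochhammer_ratios (l : list (C * C)) (k : nat) : C :=
  Cprod (map (fun p => pochhammer (fst p) k / pochhammer (snd p) k) l).

Lemma pochhammer_ratios_bound (l : list (C * C)) :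
  (forall p, In p l -> forall k : nat, snd p <> - INR k) ->
  exists B : R, 0 < B /\ forall k, Cmod (pochhammer_ratios l k) <= B ^ k.
Proof.
  unfold pochhammer_ratios. induction l as [|p l IH]; intros hl.
  - exists 1%R. split; [lra|]. intros k. simpl. rewrite Cmod_1, pow1. lra.
  - destruct IH as [B [hB HB]]; [intros; apply hl; now right|].
    destruct (pochhammer_ratio_bound (fst p) (snd p)) as [D [hD HD]]; [apply hl; now left|].
    exists (D * B)%R. split; [nra|]. intros k. simpl. rewrite Cmod_mult, Rpow_mult_distr.
    apply Rmult_le_compat; try apply Cmod_ge_0; easy.
Qed.

Lemma hypergeometrizations_expansion (l : list (C * C)) (f : C -> C) (b : nat -> C) :
  (forall p, In p l -> forall k : nat, snd p <> - INR k) ->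
  expands_at0 f b -> (forall x, f x = CSeries (fun k => b k * x ^ k)) ->
  expands_at0 (hypergeometrizations l f) (fun k => b k * pochhammer_ratios l k) /\
  forall x, hypergeometrizations l f x = CSeries (fun k => b k * pochhammer_ratios l k * x ^ k).
Proof.
  intros hl hb hf. induction l as [|p l IH].
  - assert (e : forall k, b k * pochhammer_ratios nil k = b k).
    { intros k. apply Cmult_1_r. }
    split.
    + destruct hb as [r [hr H]]. exists r. split; [easy|]. intros x hx.
      apply Cis_series_ext with (2 := H x hx). intros k. now rewrite e.
    + intros x. simpl. rewrite hf. apply CSeries_ext. intros k. now rewrite e.
  - destruct IH as [IH _]; [intros; apply hl; now right|].
    destruct (hypergeometrization_expansion (fst p) (snd p) _ _ (hl p (or_introl eq_refl)) IH)
      as [[r [hr H]] H'].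
    assert (e : forall k, b k * pochhammer_ratios l k * (pochhammer (fst p) k / pochhammer (snd p) k)
      = b k * pochhammer_ratios (p :: l) k).
    { intros k. unfold pochhammer_ratios. simpl. ring. }
    split.
    + exists r. split; [easy|]. intros x hx.
      apply Cis_series_ext with (2 := H x hx). intros k. now rewrite e.
    + intros x. simpl. rewrite H'. apply CSeries_ext. intros k. now rewrite e.
Qed.

(** * Averaging over the roots of unity *)

Lemma INR_neq_0_C (n : nat) : (n <> 0)%nat -> RtoC (INR n) <> 0.
Proof. intros h. apply RtoC_neq. now apply not_0_INR. Qed.

Lemma fact_neq_0_C (n : nat) : RtoC (INR (fact n)) <> 0.
Proof. apply INR_neq_0_C, fact_neq_0. Qed.

Lemma Cexp_pow (z : C) (p : nat) : Cexp z ^ p = Cexp (INR p * z).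
Proof.
  induction p as [|p IH].
  - simpl. replace (0 * z) with (RtoC 0) by ring. unfold Cexp. simpl.
    rewrite exp_0, cos_0, sin_0. apply injective_projections; simpl; ring.
  - rewrite Cpow_S, IH, <- Cexp_plus. f_equal. rewrite S_INR, RtoC_plus. ring.
Qed.

Lemma Cexp_two_pi_multiple (p : nat) : Cexp (2 * PI * Ci * INR p) = 1.
Proof.
  replace (2 * PI * Ci * INR p) with (RtoC (INR p) * (2 * PI * Ci)) by ring.
  rewrite <- Cexp_pow.
  replace (Cexp (2 * PI * Ci)) with (RtoC 1); [apply Cpow_1_l|].
  replace (2 * PI * Ci) with ((0, 2 * PI)%R : C) by (apply injective_projections; simpl; ring).
  unfold Cexp. simpl. rewrite exp_0, sin_2PI, cos_2PI.
  apply injective_projections; simpl; ring.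
Qed.

(** The root has argument [2 * h] with [0 < h < PI], and
    [cos (2 * h) = 1 - 2 * sin h ^ 2 < 1]. *)
Lemma unity_root_neq_1 (n s : nat) : (0 < s < n)%nat -> unity_root n s <> 1.
Proof.
  intros hs e. assert (hn : 0 < INR n) by (apply lt_0_INR; lia).
  assert (hs0 : 0 < INR s) by (apply lt_0_INR; lia).
  assert (hsn : INR s < INR n) by (apply lt_INR; lia).
  set (h := (PI * INR s / INR n)%R).
  assert (hh : 0 < h < PI).
  { assert (hpi := PI_RGT_0). unfold h. split.
    - apply Rdiv_lt_0_compat; [nra|easy].
    - apply Rmult_lt_reg_r with (INR n); [easy|]. field_simplify; [nra|lra]. }
  assert (hz : 2 * PI * Ci * INR s / INR n = RtoC (2 * h) * Ci).
  { unfold h. rewrite RtoC_mult, RtoC_div, RtoC_mult by lra. field.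
    now apply INR_neq_0_C; lia. }
  unfold unity_root in e. rewrite hz in e.
  apply (f_equal Re) in e. unfold Cexp in e. simpl in e.
  replace (2 * h * 0 - 0 * 1)%R with 0%R in e by ring.
  replace (2 * h * 1 + 0 * 0)%R with (2 * h)%R in e by ring.
  rewrite exp_0, cos_2a_sin in e. assert (hp := sin_gt_0 h). nra.
Qed.

Definition Csum (l : list C) : C := fold_right Cplus 0 l.

Lemma Csum_map_mult_l {A : Type} (w : C) (g : A -> C) (l : list A) :
  Csum (map (fun j => w * g j) l) = w * Csum (map g l).
Proof. unfold Csum. induction l as [|j l IH]; simpl; [ring|rewrite IH; ring]. Qed.

Lemma Csum_app (l1 l2 : list C) : Csum (l1 ++ l2) = Csum l1 + Csum l2.
Proof. unfold Csum. induction l1 as [|j l IH]; simpl; [ring|rewrite IH; ring]. Qed.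

Lemma Csum_geometric (w : C) (n : nat) :
  (w - 1) * Csum (map (fun j => w ^ j) (seq 0 n)) = w ^ n - 1.
Proof.
  induction n as [|n IH]; [simpl; unfold Csum; simpl; ring|].
  rewrite seq_S, map_app, Csum_app, Cmult_plus_distr_l, IH. unfold Csum. simpl. ring.
Qed.

Lemma unity_root_pow_swap (n j p : nat) : unity_root n j ^ p = unity_root n p ^ j.
Proof. unfold unity_root. rewrite !Cexp_pow. f_equal. unfold Cdiv. ring. Qed.

Lemma unity_root_mod (n p : nat) : (n <> 0)%nat -> unity_root n p = unity_root n (p mod n).
Proof.
  intros hn. unfold unity_root.
  rewrite (Nat.div_mod p n hn) at 1.
  rewrite <- (Cmult_1_l (Cexp (_ * INR (p mod n) / _))), <- (Cexp_two_pi_multiple (p / n)), <- Cexp_plus.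
  f_equal. rewrite plus_INR, mult_INR, RtoC_plus, RtoC_mult. field. now apply INR_neq_0_C.
Qed.

Lemma Csum_map_1 {A : Type} (l : list A) : Csum (map (fun _ => RtoC 1) l) = INR (length l).
Proof.
  induction l as [|j l IH]; [easy|]. unfold Csum in *. simpl length. simpl map. simpl fold_right.
  rewrite IH, S_INR, RtoC_plus. ring.
Qed.

(** The sum is geometric in the [p]-th root of unity, which equals 1 exactly
    when [n] divides [p]. *)
Lemma sum_unity_roots_pow (n p : nat) : (n <> 0)%nat ->
  Csum (map (fun j => unity_root n j ^ p) (seq 0 n))
  = if Nat.eq_dec (p mod n) 0 then RtoC (INR n) else 0.
Proof.
  intros hn. rewrite (map_ext _ _ (fun j => unity_root_pow_swap n j p)), unity_root_mod by easy.
  destruct (Nat.eq_dec (p mod n) 0) as [e|e].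
  - rewrite e.
    replace (unity_root n 0) with (RtoC 1).
    2:{ unfold unity_root. rewrite <- (Cexp_two_pi_multiple 0). f_equal. simpl. field.
        now apply INR_neq_0_C. }
    rewrite (map_ext _ _ Cpow_1_l), Csum_map_1. now rewrite length_seq.
  - set (w := unity_root n (p mod n)).
    assert (hw : w <> 1).
    { apply unity_root_neq_1. generalize (Nat.mod_upper_bound p n hn). lia. }
    assert (hwn : w ^ n = 1).
    { unfold w, unity_root. rewrite Cexp_pow, <- (Cexp_two_pi_multiple (p mod n)). f_equal.
      field. now apply INR_neq_0_C. }
    assert (hg := Csum_geometric w n). rewrite hwn in hg.
    assert (hw1 : w - 1 <> 0).
    { intros h. apply hw. replace w with (w - 1 + 1) by ring. rewrite h. ring. }
    replace (Csum _) with (/ (w - 1) * ((w - 1) * Csum (map (fun j => w ^ j) (seq 0 n)))).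
    + rewrite hg. ring.
    + rewrite Cmult_assoc, Cinv_l by easy. apply Cmult_1_l.
Qed.

Lemma Cis_series_sum {A : Type} (t : A -> nat -> C) (s : A -> C) (l : list A) :
  (forall j, Cis_series (t j) (s j)) ->
  Cis_series (fun k => Csum (map (fun j => t j k) l)) (Csum (map s l)).
Proof.
  intros H. induction l as [|j l IH].
  - apply Cis_series_iff. intros eps he. exists 0%nat. intros N _.
    assert (e : @sum_n C_AbelianMonoid (fun _ => RtoC 0) N = RtoC 0).
    { induction N as [|N IH]; [apply sum_O|].
      rewrite sum_Sn, IH. exact (Cplus_0_l 0). }
    unfold Csum. simpl. rewrite e. replace (0 - 0) with (RtoC 0) by ring. now rewrite Cmod_0.
  - exact (@is_series_plus C_AbsRing C_NormedModule _ _ _ _ (H j) IH).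
Qed.

(** The partial sums of the thinned series form a subsequence of those of
    the original one. *)
Lemma Cis_series_multiples (n : nat) (t : nat -> C) (s : C) : (n <> 0)%nat ->
  (forall p, (p mod n <> 0)%nat -> t p = 0) ->
  Cis_series t s -> Cis_series (fun k => t (n * k)%nat) s.
Proof.
  intros hn ht H.
  assert (between : forall K r, (r < n)%nat ->
    @sum_n C_AbelianMonoid t (n * K + r) = @sum_n C_AbelianMonoid t (n * K)).
  { intros K r. induction r as [|r IH]; intros hr; [now rewrite Nat.add_0_r|].
    rewrite Nat.add_succ_r, sum_Sn, IH, ht by
      (try rewrite <- Nat.add_succ_r, Nat.mul_comm, Nat.add_comm, Nat.Div0.mod_add, Nat.mod_small; lia).
    exact (Cplus_0_r _). }
  assert (partial : forall K, @sum_n C_AbelianMonoid (fun k => t (n * k)%nat) K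
    = @sum_n C_AbelianMonoid t (n * K)).
  { induction K as [|K IH]; [now rewrite Nat.mul_0_r, !sum_O, Nat.mul_0_r|].
    rewrite sum_Sn, IH, <- (between K (n - 1)%nat) by lia.
    replace (n * S K)%nat with (S (n * K + (n - 1))) by lia.
    now rewrite sum_Sn. }
  apply Cis_series_iff. intros eps he.
  destruct (proj1 (Cis_series_iff t s) H eps he) as [N hN].
  exists N. intros K hK. rewrite partial. apply hN. nia.
Qed.

Lemma exp_mean_series (n : nat) (root : C -> C) : (n <> 0)%nat -> is_root_branch n root ->
  forall x : C, Cis_series (fun k => INR (n ^ (n * k)) * x ^ k / INR (fact (n * k)))
       (exp_mean n root x).
Proof.
  intros hn hroot x. set (y := root x).
  assert (hn0 := INR_neq_0_C n hn).
  (* The Taylor terms of the mean, seen as a series in [y]. *)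
  set (t := fun p => / INR n *
    Csum (map (fun j => (INR n * unity_root n j * y) ^ p / INR (fact p)) (seq 0 n))).
  assert (ht : forall p, t p = if Nat.eq_dec (p mod n) 0 then (INR n * y) ^ p / INR (fact p) else 0).
  { intros p. unfold t.
    rewrite (map_ext _ (fun j => (INR n * y) ^ p / INR (fact p) * unity_root n j ^ p)).
    2:{ intros j. rewrite !Cpow_mult_l. unfold Cdiv. ring. }
    rewrite Csum_map_mult_l, sum_unity_roots_pow by easy.
    destruct (Nat.eq_dec (p mod n) 0); field; repeat split; try easy; apply fact_neq_0_C. }
  apply Cis_series_ext with (fun k => t (n * k)%nat).
  - intros k. rewrite ht, Nat.mul_comm, Nat.Div0.mod_mul, Nat.mul_comm. simpl.
    rewrite pow_INR, RtoC_pow, Cpow_mult_l.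
    rewrite (Cpow_mult_r y). unfold y. now rewrite hroot.
  - apply Cis_series_multiples; [easy| |].
    + intros p hp. rewrite ht. now destruct (Nat.eq_dec (p mod n) 0).
    + apply Cis_series_scal.
      apply (Cis_series_sum (fun j p => (INR n * unity_root n j * y) ^ p / INR (fact p))).
      intros j. apply Cexp_series.
Qed.

(** * Gauss multiplication of Pochhammer symbols *)

Lemma Cprod_app (l1 l2 : list C) : Cprod (l1 ++ l2) = Cprod l1 * Cprod l2.
Proof. unfold Cprod. induction l1 as [|j l IH]; simpl; [ring|rewrite IH; ring]. Qed.

Lemma Cprod_map_mult {A : Type} (g h : A -> C) (l : list A) :
  Cprod (map (fun j => g j * h j) l) = Cprod (map g l) * Cprod (map h l).
Proof. unfold Cprod. induction l as [|j l IH]; simpl; [ring|rewrite IH; ring]. Qed.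

Lemma Cprod_map_const {A : Type} (w : C) (l : list A) :
  Cprod (map (fun _ => w) l) = w ^ length l.
Proof. unfold Cprod. induction l as [|j l IH]; simpl; [ring|rewrite IH; ring]. Qed.

Lemma fact_add (p n : nat) :
  RtoC (INR (fact (p + n))) = INR (fact p) * Cprod (map (fun j => INR p + INR j) (seq 1 n)).
Proof.
  induction n as [|n IH]; [rewrite Nat.add_0_r; simpl; unfold Cprod; simpl; ring|].
  rewrite seq_S, map_app, Cprod_app, Cmult_assoc, <- IH, Nat.add_succ_r.
  change (fact (S (p + n))) with (S (p + n) * fact (p + n))%nat.
  rewrite mult_INR, RtoC_mult.
  replace (S (p + n)) with (p + S n)%nat by lia. rewrite plus_INR, RtoC_plus.
  unfold Cprod. cbn [map fold_right Nat.add]. ring.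
Qed.

(** From [k] to [k + 1] the left side gains [prod_(j=1)^n (n k + j)], which
    is [n^n * prod_(j=1)^n (k + j/n)]; the factor [j = n] is the one that extends
    [k!]. *)
Lemma pochhammer_multiplication (n k : nat) : (n <> 0)%nat ->
  RtoC (INR (fact (n * k))) = INR (n ^ (n * k)) * INR (fact k) *
    Cprod (map (fun j : nat => pochhammer (INR j / INR n) k) (seq 1 (n - 1))).
Proof.
  intros hn. assert (hn0 := INR_neq_0_C n hn).
  induction k as [|k IH].
  - rewrite Nat.mul_0_r. simpl pochhammer. rewrite Cprod_map_const, Cpow_1_l. simpl. ring.
  - replace (n * S k)%nat with (n * k + n)%nat by lia.
    rewrite fact_add, IH, Nat.pow_add_r, (mult_INR (n ^ (n * k))).
    rewrite (map_ext (fun j => INR (n * k) + INR j)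
      (fun j => INR n * (INR j / INR n + INR k))).
    2:{ intros j. rewrite mult_INR, RtoC_mult. field. easy. }
    rewrite Cprod_map_mult, Cprod_map_const, length_seq.
    replace (seq 1 n) with (seq 1 (n - 1) ++ n :: nil).
    2:{ replace n with (S (n - 1)) at 3 by lia. rewrite seq_S. do 2 f_equal. lia. }
    rewrite map_app, Cprod_app. simpl pochhammer. rewrite Cprod_map_mult.
    change (fact (S k)) with (S k * fact k)%nat.
    rewrite mult_INR, !RtoC_mult, S_INR, RtoC_plus, (pow_INR n n), RtoC_pow.
    unfold Cprod. simpl map. simpl fold_right. field. easy.
Qed.

Lemma Cprod_pochhammer_neq_0 (c : list C) (k : nat) :
  (forall q, In q c -> forall j : nat, q <> - INR j) ->
  Cprod (map (fun q => pochhammer q k) c) <> 0.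
Proof.
  intros hc. unfold Cprod. induction c as [|q c IH]; simpl; [apply RtoC_neq; lra|].
  apply Cmult_neq_0.
  - apply pochhammer_neq_0, hc. now left.
  - apply IH. intros p hp. apply hc. now right.
Qed.

Lemma pochhammer_ratios_combine (u c : list C) (k : nat) :
  length u = length c -> (forall q, In q c -> forall j : nat, q <> - INR j) ->
  pochhammer_ratios (combine u c) k =
  Cprod (map (fun q => pochhammer q k) u) / Cprod (map (fun q => pochhammer q k) c).
Proof.
  intros hl hc. unfold pochhammer_ratios. revert c hl hc.
  induction u as [|p u IH]; intros [|q c] hl hc; try easy.
  - unfold Cprod. simpl. field.
  - assert (hc' : forall p, In p c -> forall j : nat, p <> - INR j).
    { intros r hr. apply hc. now right. }
    assert (h := Cprod_pochhammer_neq_0 c k hc').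
    assert (hq : pochhammer q k <> 0) by (apply pochhammer_neq_0, hc; now left).
    specialize (IH c ltac:(simpl in hl; lia) hc').
    unfold Cprod in *. simpl. rewrite IH. field. easy.
Qed.

(** * The hypergeometric function as a hypergeometrization *)

Theorem proposition2 (n m : nat) (hn : (1 <= n)%nat)
  (root : C -> C) (hroot : is_root_branch n root)
  (a c : list C) (ha : length a = m) (hc : length c = (m + n - 1)%nat)
  (hc0 : forall q : C, In q c -> forall k : nat, q <> - INR k) :
  (forall x : C,
     Cis_series (fun k => INR (n ^ (n * k)) * x ^ k / INR (fact (n * k)))
       (exp_mean n root x)) /\
  (forall x : C, Cex_series (hyper_term a c x)) /\
  (forall x : C,
     pFq a c x =
     hypergeometrizations
       (combine (map (fun j : nat => INR j / INR n) (seq 1 (n - 1)) ++ a) c)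
       (exp_mean n root) x).
Proof.
  assert (hn0 : (n <> 0)%nat) by lia.
  assert (hf := exp_mean_series n root hn0 hroot).
  split; [exact hf|].
  set (b := fun k => INR (n ^ (n * k)) / INR (fact (n * k)) : C).
  assert (hb : forall x, Cis_series (fun k => b k * x ^ k) (exp_mean n root x)).
  { intros x. apply Cis_series_ext with (2 := hf x). intros k. unfold b, Cdiv. ring. }
  set (u := map (fun j : nat => INR j / INR n) (seq 1 (n - 1))).
  set (l := combine (u ++ a) c).
  assert (hl : forall p, In p l -> forall k : nat, snd p <> - INR k).
  { intros [p q] hp. apply hc0. now apply in_combine_r in hp. }
  assert (hlen : length (u ++ a) = length c).
  { unfold u. rewrite length_app, length_map, length_seq. lia. }
  assert (hterm : forall x k, b k * pochhammer_ratios l k * x ^ k = hyper_term a c x k).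
  { intros x k. unfold l, hyper_term, b.
    rewrite (pochhammer_ratios_combine (u ++ a) c k hlen hc0).
    assert (h := Cprod_pochhammer_neq_0 c k hc0).
    assert (hg := pochhammer_multiplication n k hn0).
    assert (hfact := fact_neq_0_C (n * k)).
    rewrite map_app, Cprod_app. unfold u. rewrite map_map. rewrite hg in hfact |- *.
    field. repeat split; try easy; intros e; apply hfact; rewrite e; ring. }
  assert (hexp : expands_at0 (exp_mean n root) b).
  { exists 1%R. split; [lra|]. intros x _. apply hb. }
  split; intros x.
  - destruct (pochhammer_ratios_bound l hl) as [B [hB HB]].
    (* Any point of modulus greater than [B * |x|] dominates the series at [x]. *)
    destruct (Cex_series_dominated b (fun k => b k * pochhammer_ratios l k) B x
      (RtoC (B * Cmod x + 1))) as [s hs].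
    + eexists. apply hb.
    + intros k. rewrite Cmod_mult. apply Rmult_le_compat_l; [apply Cmod_ge_0|apply HB].
    + lra.
    + assert (hx := Cmod_ge_0 x). rewrite Cmod_R, Rabs_pos_eq; nra.
    + exists s. now apply Cis_series_ext with (2 := hs).
  - destruct (hypergeometrizations_expansion l (exp_mean n root) b hl hexp) as [_ H].
    { intros y. symmetry. apply CSeries_unique, hb. }
    rewrite H. apply CSeries_ext. intros k. symmetry. apply hterm.
Qed.
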